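(* Let $c\neq0$, $\eta>0$ and $e\in\mathbb R$ be constants, $v\in\mathbb R^n$ a constant vector, and $\mathcal U\subset\{x\in\mathbb R^n:4c^2|x|^2<1\}$ open and convex. Put $$F=\frac{\sqrt{|y|^2-4c^2\left(|x|^2|y|^2-\langle x,y\rangle^2\right)}+2c\langle x,y\rangle}{1-4c^2|x|^2},$$ $$\widetilde F=\frac{\eta\left(\sqrt{|y|^2-4c^2\left(|x|^2|y|^2-\langle x,y\rangle^2\right)}+2c\langle x,y\rangle\right)^2}{(1-4c^2|x|^2)^2\sqrt{|y|^2-4c^2\left(|x|^2|y|^2-\langle x,y\rangle^2\right)}}\left(2c\langle v,x\rangle+e+\frac{\langle v,y\rangle}{F}\right),$$ and suppose the constants are such that $\widetilde F$ is positive for $y\ne0$ and is a Finsler metric on $\mathcal U$. Then $\widetilde F$ is projectively flat with projective factor $P=2cF$, and it has zero flag curvature.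
   Context: $|\cdot|$, $\langle\cdot,\cdot\rangle$ are the Euclidean norm and inner product; $(x^i,y^i)$ are the canonical coordinates on $\mathcal U\times\mathbb R^n$, $n\ge2$; $\mathcal C=y^i\frac{\partial}{\partial y^i}$, $J=dx^i\otimes\frac{\partial}{\partial y^i}$, $d_Ju=\frac{\partial u}{\partial y^i}dx^i$. A Finsler metric is a continuous function $F$, smooth and positive for $y\ne0$, positively $1$-homogeneous in $y$, with $\frac12\frac{\partial^2F^2}{\partial y^i\partial y^j}$ of rank $n$ for $y\neq0$; such expressions are extended by $0$ at $y=0$. Its geodesic spray is the unique vector field $S=y^i\frac{\partial}{\partial x^i}-2G^i\frac{\partial}{\partial y^i}$ with $i_S\,dd_JF^2=-dF^2$. $F$ is projectively flat if its geodesic spray is $S_0-2P\mathcal C$, where $S_0=y^i\frac{\partial}{\partial x^i}$ and $P$ is $1$-homogeneous in $y$; $P=\frac{S_0F}{2F}$ is its projective factor. With $N^i_j=\partial G^i/\partial y^j$, $\frac{\delta}{\delta x^i}=\frac{\partial}{\partial x^i}-N^j_i\frac{\partial}{\partial y^j}$ and $\Phi=R^i_j\frac{\partial}{\partial y^i}\otimes dx^j$, $R^i_j=2\frac{\delta G^i}{\delta x^j}-S(N^i_j)+N^i_kN^k_j$, $F$ has constant flag curvature $\kappa$ if $\Phi=\kappa F^2J-\kappa F\,d_JF\otimes\mathcal C$ with $\kappa$ constant; zero flag curvature means $\kappa=0$. *)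

(* Defs.v *)
From HB Require Import structures.
From mathcomp Require Import all_boot all_order all_algebra.
From mathcomp Require Import all_classical all_reals all_analysis.

Set Implicit Arguments.
Unset Strict Implicit.
Unset Printing Implicit Defensive.

Import Order.TTheory GRing.Theory Num.Theory.
Import numFieldNormedType.Exports.

Local Open Scope classical_set_scope.
Local Open Scope ring_scope.

Section Euclidean.
Context {R : realType} {n : nat}.

(* The library norm on ['rV[R]_n] is the sup norm: it is only used for the
   (identical) topology, and the Euclidean norm is defined here. *)
Definition dot (x y : 'rV[R]_n) : R := \sum_(i < n) x 0 i * y 0 i.

Definition enorm (x : 'rV[R]_n) : R := Num.sqrt (dot x x).

End Euclidean.

(* Smoothness on an open set: every iterated directional derivative is Frechet
   differentiable, hence continuous, at each point of [A]. *)
Definition smooth_on {R : realType} {V W : normedModType R}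
    (A : set V) (f : V -> W) : Prop :=
  forall (vs : seq V) (p : V), A p ->
    differentiable (foldr (fun (v : V) (g : V -> W) => 'D_v g) f vs) p.

Section Finsler.
Context {R : realType} {n : nat}.
Local Notation vec := 'rV[R]_n.

(* [U * R^n] sits in [tb]; a point is a pair [p = (x, y)], and a tangent vector
   at [p] is identified with an element of [tb]. *)
Local Notation tb := (vec * vec)%type.

Definition slit_bundle (U : set vec) : set tb :=
  [set p | U p.1 /\ p.2 != 0].

Definition ddx (i : 'I_n) : tb := (delta_mx 0 i, 0).
Definition ddy (i : 'I_n) : tb := (0, delta_mx 0 i).

Definition vertJ (X : tb) : tb := (0, X.1).
Definition liouville (p : tb) : tb := (0, p.2).
Definition S0 (p : tb) : tb := (p.2, 0).

Definition pos_homogeneous1 (U : set vec) (f : tb -> R) : Prop :=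
  forall (x y : vec) (l : R), U x -> 0 < l -> f (x, l *: y) = l * f (x, y).

Definition fund_tensor (F : tb -> R) (p : tb) : 'M[R]_n :=
  \matrix_(i, j) (2^-1 * 'D_(ddy i) ('D_(ddy j) (fun q => F q ^+ 2)) p).

Record finsler_metric (U : set vec) (F : tb -> R) : Prop := FinslerMetric {
  finsler_continuous : {within [set p : tb | U p.1], continuous F} ;
  finsler_smooth : smooth_on (slit_bundle U) F ;
  finsler_pos : forall p : tb, slit_bundle U p -> 0 < F p ;
  finsler_homog : pos_homogeneous1 U F ;
  finsler_regular : forall p : tb, slit_bundle U p ->
    \rank (fund_tensor F p) = n
}.

(* One-forms are functions of a point and a tangent vector, two-forms of a
   point and two tangent vectors. *)
Definition d0 (f : tb -> R) (p X : tb) : R := 'D_X f p.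

Definition dJ (f : tb -> R) (p X : tb) : R := 'D_(vertJ X) f p.

(* Cartan's formula with [X] and [Y] extended to constant vector fields, whose
   bracket vanishes. *)
Definition d1 (w : tb -> tb -> R) (p X Y : tb) : R :=
  'D_X (fun q => w q Y) p - 'D_Y (fun q => w q X) p.

Definition interior_prod (S : tb -> tb) (w : tb -> tb -> tb -> R)
    (p Y : tb) : R := w p (S p) Y.

(* Vector fields [y^i d/dx^i - 2 G^i d/dy^i]. *)
Definition semispray (U : set vec) (S : tb -> tb) : Prop :=
  smooth_on (slit_bundle U) S /\
  forall p : tb, slit_bundle U p -> (S p).1 = p.2.

Definition geodesic_eq (U : set vec) (F : tb -> R) (S : tb -> tb) : Prop :=
  forall p Y : tb, slit_bundle U p ->
    interior_prod S (d1 (dJ (fun q => F q ^+ 2))) p Y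
    = - d0 (fun q => F q ^+ 2) p Y.

Definition geodesic_spray (U : set vec) (F : tb -> R) (S : tb -> tb) : Prop :=
  [/\ semispray U S,
      geodesic_eq U F S &
      forall S' : tb -> tb, semispray U S' -> geodesic_eq U F S' ->
        forall p : tb, slit_bundle U p -> S' p = S p].

Definition projectively_flat_with (U : set vec) (F P : tb -> R) : Prop :=
  pos_homogeneous1 U P /\
  geodesic_spray U F (fun p => S0 p - (2 * P p) *: liouville p).

Definition projective_factor (F : tb -> R) (p : tb) : R :=
  'D_(S0 p) F p / (2 * F p).

Definition spray_coef (S : tb -> tb) (i : 'I_n) (p : tb) : R :=
  - (S p).2 0 i / 2.

(* [connection S i j] is [N^i_j]. *)
Definition connection (S : tb -> tb) (i j : 'I_n) : tb -> R :=
  'D_(ddy j) (spray_coef S i).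

Definition delta_x (S : tb -> tb) (i : 'I_n) (f : tb -> R) (p : tb) : R :=
  'D_(ddx i) f p - \sum_(j < n) connection S j i p * 'D_(ddy j) f p.

(* [jacobi_coef S i j] is [R^i_j]. *)
Definition jacobi_coef (S : tb -> tb) (i j : 'I_n) (p : tb) : R :=
  2 * delta_x S j (spray_coef S i) p
  - 'D_(S p) (connection S i j) p
  + \sum_(k < n) connection S i k p * connection S k j p.

Definition jacobi_endo (S : tb -> tb) (p X : tb) : tb :=
  \sum_(i < n) \sum_(j < n) (jacobi_coef S i j p * X.1 0 j) *: ddy i.

Definition constant_flag_curvature (U : set vec) (F : tb -> R) (kappa : R) :
    Prop :=
  exists S : tb -> tb, geodesic_spray U F S /\
    forall p X : tb, slit_bundle U p ->
      jacobi_endo S p X =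
      (kappa * F p ^+ 2) *: vertJ X - (kappa * F p * dJ F p X) *: liouville p.

Definition disc_root (c : R) (p : tb) : R :=
  Num.sqrt (enorm p.2 ^+ 2
            - 4 * c ^+ 2 * (enorm p.1 ^+ 2 * enorm p.2 ^+ 2
                            - dot p.1 p.2 ^+ 2)).

Definition Fmetric (c : R) (p : tb) : R :=
  (disc_root c p + 2 * c * dot p.1 p.2) / (1 - 4 * c ^+ 2 * enorm p.1 ^+ 2).

(* At [y = 0] the first factor vanishes, as its numerator does and [0^-1 = 0]:
   the formula is extended by [0] there. *)
Definition Ftilde (c eta e : R) (v : vec) (p : tb) : R :=
  eta * (disc_root c p + 2 * c * dot p.1 p.2) ^+ 2
  / ((1 - 4 * c ^+ 2 * enorm p.1 ^+ 2) ^+ 2 * disc_root c p)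
  * (2 * c * dot v p.1 + e + dot v p.2 / Fmetric c p).

End Finsler.

(* Main.v *)
Require Import Defs.
From HB Require Import structures.
From mathcomp Require Import all_boot all_order all_algebra.
From mathcomp Require Import all_classical all_reals all_analysis.
From mathcomp Require Import ring.

Set Implicit Arguments.
Unset Strict Implicit.
Unset Printing Implicit Defensive.

Import Order.TTheory GRing.Theory Num.Theory.
Import numFieldNormedType.Exports.

Local Open Scope classical_set_scope.
Local Open Scope ring_scope.

(** Write [F] for [Fmetric c], the Funk-type metric, and [D] for [disc_root c].
    Everything follows from two first-order equations: with [P = 2cF] and
    subscripts for partial derivatives,

      P_{x^i} = P P_{y^i}    and    (Ftilde)_{x^i} = (P Ftilde)_{y^i}.

    The first one holds because [F] is the positive root of
    [(1 - 4c^2|x|^2) F^2 - 4c<x,y> F - |y|^2 = 0]: differentiating this equation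
    gives [D F_{y^i} = 2c x_i F + y_i] and [F_{x^i} = 2cF F_{y^i}]
    ([Fmetric_derive]).  For the second one, [Ftilde = eta (F^2/D) h] with
    [h = 2c<v,x> + e + <v,y>/F]; the first factor solves
    [B_{x^i} = (2cF B)_{y^i}] and [h] solves the transport equation
    [h_{x^i} = 2cF h_{y^i}], so their product solves the same equation as [B]
    ([Ftilde_dx]).

    Given the second equation, Euler's identity for homogeneous functions and
    the symmetry of second derivatives give [S0 Ftilde = 2P Ftilde] and Hamel's
    equation [S0 (Ftilde_{y^i}) = Ftilde_{x^i}]; these say that [S0 - 2PC] solves
    the geodesic equation of [Ftilde], and the solution is unique because the
    fundamental tensor is nondegenerate ([projective_geodesic_spray]).  They also
    identify the projective factor.  Given the first equation, the spray
    coefficients [G^i = P y^i] and [S0 P = P^2] make all terms of the Jacobi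
    endomorphism cancel ([projective_spray_flat]).

    The symmetry of second derivatives is proved here for Frechet differentiable
    first derivatives ([derive_comm]), and [P] is shown to be smooth from
    the stability of iterated differentiability under the operations that
    build [F]. *)

(** * Directional derivatives and their symmetry *)

Section Calculus.
Context {R : realType} {V W : normedModType R}.

(** Brings one-variable results, such as the mean value theorem, to a line in a
    normed space. *)
Lemma is_derive_line (f : V -> W) (p v : V) (t : R) :
  differentiable f (t *: v + p) ->
  is_derive t (1 : R) (fun s => f (s *: v + p)) ('D_v f (t *: v + p)).
Proof.
move=> df.
have E : (fun h : R => h^-1 *: (f ((h *: 1 + t) *: v + p) - f (t *: v + p)))
       = (fun h => h^-1 *: (f (h *: v + (t *: v + p)) - f (t *: v + p))).
  by apply/funext => h; rewrite [h *: 1]mulr1 scalerDl addrA.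
have /derivableP [d _] : derivable f (t *: v + p) v by exact: diff_derivable.
split; first by rewrite /derivable E.
by rewrite /derive E.
Qed.

Lemma deriveDdir (f : V -> W) (p u v : V) : differentiable f p ->
  'D_(u + v) f p = 'D_u f p + 'D_v f p.
Proof. by move=> df; rewrite !deriveE// linearD. Qed.

Lemma deriveZdir (f : V -> W) (p u : V) (k : R) : differentiable f p ->
  'D_(k *: u) f p = k *: 'D_u f p.
Proof. by move=> df; rewrite !deriveE// linearZ. Qed.

Lemma near_eq_differentiable (f g : V -> W) (p : V) :
  (\near p, f p = g p) -> differentiable f p -> differentiable g p.
Proof.
move=> fg df.
have fgp : f p = g p by exact: nbhs_singleton fg.
have gE : g \o shift p = cst (g p) + 'd f p +o_ 0 id.
  apply/eqaddoP => e e0.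
  have /eqaddoP/(_ e e0) H := diff_locally df.
  have fg0 : \forall h \near (0 : V), f (h + p) = g (h + p).
    by move: fg; rewrite (near_shift 0 p) subr0.
  apply: filterS2 H fg0 => h /= H E.
  by move: H; rewrite /cst /= !fctE -E fgp.
apply/diff_locallyP.
have D := diff_unique (diff_continuous df) gE.
by rewrite D; split => //; exact: diff_continuous.
Qed.

End Calculus.

Section Schwarz.
Context {R : realType} {V : normedModType R}.
Variables (f : V -> R) (p : V).
Hypothesis fdiff : \forall q \near p, differentiable f q.

(** The second difference is the increment over [[0, t]] of
    [s |-> f (p + su + tv) - f (p + su)]; the mean value theorem turns it into
    [t] times an increment of ['D_u f], which the differential of ['D_u f] at [p]
    evaluates up to [o(t)]. *)
Lemma second_difference (u v : V) : differentiable ('D_u f) p ->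
  forall e : R, 0 < e -> \forall t \near (0 : R)^'+,
    `|f (t *: u + t *: v + p) - f (t *: u + p) - f (t *: v + p) + f p
      - t ^+ 2 * 'D_v ('D_u f) p| <= e * t ^+ 2.
Proof.
move=> dg e e0.
pose M : R := `|u| + `|v| + 1.
have M0 : 0 < M by rewrite ltr_wpDl// addr_ge0.
(* The two increments of ['D_u f] each contribute an error [k * (t * M)]. *)
pose k : R := e / (2 * M).
have k0 : 0 < k by rewrite divr_gt0// mulr_gt0.
have /eqaddoP/(_ k k0) := diff_locally dg.
move: fdiff; rewrite (near_shift 0 p) subr0 => nf ng.
have [d /= d0 dP] := nbhs_norm0P.1 (filterI nf ng).
near=> t.
have t0 : 0 < t by [].
have tM : t * M < d.
  by rewrite -ltr_pdivlMr//; near: t; apply: nbhs_right_lt; exact: divr_gt0.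
have small (s r : R) : 0 <= s <= t -> 0 <= r <= t ->
    `|s *: u + r *: v| <= t * M.
  move=> /andP[s0 st] /andP[r0 rt]; rewrite (le_trans (ler_normD _ _))//.
  rewrite !normrZ (ger0_norm s0) (ger0_norm r0) /M !mulrDr mulr1.
  rewrite ler_wpDr ?(ltW t0)//.
  by rewrite lerD// ler_wpM2r.
have near_p (s r : R) : 0 <= s <= t -> 0 <= r <= t ->
    differentiable f (s *: u + (r *: v + p)) /\
    `|'D_u f (s *: u + (r *: v + p))
      - ('D_u f p + (s *: 'D_u ('D_u f) p + r *: 'D_v ('D_u f) p))|
      <= k * (t * M).
  move=> sI rI; rewrite addrA.
  have [|df H] := dP (s *: u + r *: v); first exact: le_lt_trans (small _ _ sI rI) tM.
  split=> //; rewrite (deriveE u dg) (deriveE v dg) -!linearZ -linearD.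
  by rewrite (le_trans H)// ler_wpM2l ?(ltW k0)//; exact: small.
have tI : 0 <= t <= t by rewrite lexx ltW.
have zI : 0 <= (0 : R) <= t by rewrite lexx ltW.
pose phi (s : R) : R := f (s *: u + (t *: v + p)) - f (s *: u + (0 *: v + p)).
pose dphi (s : R) : R :=
  'D_u f (s *: u + (t *: v + p)) - 'D_u f (s *: u + (0 *: v + p)).
have phiD s : 0 <= s <= t -> is_derive s (1 : R) phi (dphi s).
  move=> sI; apply: is_deriveB; apply: is_derive_line;
  by have [] := near_p _ _ sI tI; have [] := near_p _ _ sI zI.
have [||c cI] := @MVT _ phi dphi 0 t t0.
- by move=> s; rewrite in_itv/= => /andP[s0 st]; apply: phiD; rewrite !ltW.
- apply: derivable_within_continuous => s; rewrite in_itv/= => sI.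
  by have [] := phiD _ sI.
have {}cI : 0 <= c <= t by move: cI; rewrite in_itv/= => /andP[? ?]; rewrite !ltW.
rewrite subr0 {1 2}/phi !scale0r !add0r => E.
rewrite addrA in E.
have {E} -> : f (t *: u + t *: v + p) - f (t *: u + p) - f (t *: v + p) + f p
  = dphi c * t by rewrite -E; ring.
have [_ H1] := near_p _ _ cI tI; have [_ H2] := near_p _ _ cI zI.
move: H1 H2; rewrite /dphi.
set g0 := 'D_u f p; set a := 'D_u f _; set b := 'D_u f _.
set guu := 'D_u _ p; set gvu := 'D_v _ p => H1 H2.
have -> : (a - b) * t - t ^+ 2 * gvu
  = t * ((a - (g0 + (c *: guu + t *: gvu))) - (b - (g0 + (c *: guu + 0 *: gvu)))).
  by rewrite /GRing.scale/=; ring.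
rewrite normrM gtr0_norm//.
have -> : e * t ^+ 2 = t * (k * (t * M) + k * (t * M)).
  by rewrite /k; field; rewrite gt_eqF.
rewrite ler_pM2l// (le_trans (ler_normB _ _))//.
exact: lerD.
Unshelve. all: by end_near. Qed.

(** The second difference is symmetric in [u] and [v], so both mixed derivatives
    are its limit after division by [t ^+ 2]. *)
Lemma derive_comm (u v : V) :
  differentiable ('D_u f) p -> differentiable ('D_v f) p ->
  'D_v ('D_u f) p = 'D_u ('D_v f) p.
Proof.
move=> du dv; apply/eqP; rewrite -subr_eq0 -normr_le0.
apply/ler_addgt0Pl => e e0; rewrite addr0.
have e2 : 0 < e / 2 by rewrite divr_gt0.
have n1 := second_difference v du e2; have n2 := second_difference u dv e2.
have [t [t0 [H1 H2]]] := filter_ex (filterI (nbhs_right_gt 0) (filterI n1 n2)).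
move: H2 H1; rewrite [t *: v + t *: u]addrC.
set A := 'D_u _ p; set B := 'D_v _ p.
set a := f (_ + p); set b := f (_ + p); set c := f (_ + p) => H1 H2.
rewrite -(@ler_pM2r _ (t ^+ 2)) ?exprn_gt0//.
rewrite -[X in _ * X <= _]gtr0_norm ?exprn_gt0// -normrM.
have -> : (B - A) * t ^+ 2 = (a - b - c + f p - t ^+ 2 * A)
  - (a - c - b + f p - t ^+ 2 * B) by ring.
rewrite (le_trans (ler_normB _ _))// (le_trans (lerD H1 H2))//.
by rewrite -mulrDl -splitr.
Qed.

End Schwarz.

(** * Stability of smoothness under algebraic operations *)

Section SmoothAlgebra.
Context {R : realType} {V : normedModType R} (A : set V).
Hypothesis Aopen : open A.

Lemma near_open (p : V) (Q : V -> Prop) :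
  A p -> (forall q, A q -> Q q) -> \forall q \near p, Q q.
Proof. by move=> Ap AQ; apply: filterS AQ _; exact: open_nbhs_nbhs. Qed.

Lemma smooth_on_differentiable (W : normedModType R) (f : V -> W) p :
  smooth_on A f -> A p -> differentiable f p.
Proof. by move=> sf Ap; exact: (sf [::]). Qed.

Lemma smooth_on_derive (W : normedModType R) (f : V -> W) v :
  smooth_on A f -> smooth_on A ('D_v f).
Proof. by move=> sf vs p Ap; have := sf (rcons vs v) p Ap; rewrite foldr_rcons. Qed.

(** Differentiability up to a finite order, on which induction is possible: the
    derivatives of [f^-1] and [Num.sqrt f] are expressed by these functions
    themselves, so their smoothness is obtained one order at a time. *)
Fixpoint smooth_upto (W : normedModType R) (k : nat) (f : V -> W) : Prop :=
  (forall p, A p -> differentiable f p) /\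
  (if k is k'.+1 then forall v, smooth_upto k' ('D_v f) else True).

Lemma smooth_uptoP (W : normedModType R) (f : V -> W) :
  smooth_on A f <-> forall k, smooth_upto k f.
Proof.
split=> [sf k|sf vs].
  elim: k f sf => [|k IH] f sf /=.
    by split=> // p; exact: smooth_on_differentiable.
  split=> [p|v]; first exact: smooth_on_differentiable.
  exact/IH/smooth_on_derive.
elim/last_ind: vs f sf => [|vs v IH] f sf p Ap.
  by have [d _] := sf 0; exact: d.
rewrite foldr_rcons; apply: IH => // k.
by have [_] := sf k.+1; exact.
Qed.

Lemma smooth_upto_diff (W : normedModType R) k (f : V -> W) p :
  smooth_upto k f -> A p -> differentiable f p.
Proof. by case: k => [|k] [d _]; exact: d. Qed.

Lemma smooth_upto_pred (W : normedModType R) k (f : V -> W) :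
  smooth_upto k.+1 f -> smooth_upto k f.
Proof.
elim: k f => [|k IH] f [d D]; first by split.
by split=> // v; apply: IH; exact: D.
Qed.

Lemma eq_smooth_upto (W : normedModType R) k (f g : V -> W) :
  (forall p, A p -> f p = g p) -> smooth_upto k f -> smooth_upto k g.
Proof.
have dE (f1 g1 : V -> W) p : (forall p, A p -> f1 p = g1 p) -> A p ->
    differentiable f1 p -> differentiable g1 p.
  by move=> E Ap; apply: near_eq_differentiable; exact: near_open.
elim: k f g => [|k IH] f g E [d D].
  by split=> // p Ap; apply: dE (d p Ap).
split=> [p Ap|v]; first by apply: dE (d p Ap).
apply: IH (D v) => p Ap.
by apply: near_eq_derive; exact: near_open.
Qed.

Lemma smooth_upto_cst (W : normedModType R) k (w : W) :
  smooth_upto k (fun=> w).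
Proof.
elim: k w => [|k IH] w; split=> //.
move=> v; apply: eq_smooth_upto (IH 0) => p _.
by rewrite derive_cst.
Qed.

Lemma smooth_uptoD (W : normedModType R) k (f g : V -> W) :
  smooth_upto k f -> smooth_upto k g -> smooth_upto k (fun p => f p + g p).
Proof.
elim: k f g => [|k IH] f g [df Df] [dg Dg].
  by split=> // p Ap; apply: differentiableD; [exact: df|exact: dg].
split=> [p Ap|v]; first by apply: differentiableD; [exact: df|exact: dg].
apply: eq_smooth_upto (IH _ _ (Df v) (Dg v)) => p Ap.
rewrite -[RHS]/('D_v (f + g) p) deriveD//; apply: diff_derivable;
  by [exact: df|exact: dg].
Qed.

Lemma smooth_upto_sum (W : normedModType R) k m (f : 'I_m -> V -> W) :
  (forall i, smooth_upto k (f i)) -> smooth_upto k (fun p => \sum_i f i p).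
Proof.
move=> sf; elim: m f sf => [|m IH] f sf.
  by apply: eq_smooth_upto (smooth_upto_cst k 0) => p _; rewrite big_ord0.
have := smooth_uptoD (sf ord0) (IH (fun i => f (lift ord0 i)) (fun i => sf _)).
by apply: eq_smooth_upto => p _; rewrite big_ord_recl.
Qed.

Lemma smooth_uptoM k (f g : V -> R) :
  smooth_upto k f -> smooth_upto k g -> smooth_upto k (fun p => f p * g p).
Proof.
elim: k f g => [|k IH] f g sf sg.
  have [df _] := sf; have [dg _] := sg.
  by split=> // p Ap; apply: differentiableM; [exact: df|exact: dg].
have [df Df] := sf; have [dg Dg] := sg.
split=> [p Ap|v]; first by apply: differentiableM; [exact: df|exact: dg].
have := smooth_uptoD (IH _ _ (smooth_upto_pred sf) (Dg v))
                     (IH _ _ (smooth_upto_pred sg) (Df v)).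
apply: eq_smooth_upto => p Ap.
rewrite -[RHS]/('D_v (f * g) p) deriveM//; apply: diff_derivable;
  by [exact: df|exact: dg].
Qed.

Lemma smooth_uptoZl (W : normedModType R) k (f : V -> R) (w : W) :
  smooth_upto k f -> smooth_upto k (fun p => f p *: w).
Proof.
elim: k f => [|k IH] f [df Df].
  by split=> // p Ap; apply: differentiableZl; exact: df.
split=> [p Ap|v]; first by apply: differentiableZl; exact: df.
apply: eq_smooth_upto (IH _ (Df v)) => p Ap.
have dp := df _ Ap.
by rewrite !deriveE ?diffZl//; exact: differentiableZl.
Qed.

Lemma smooth_uptoV k (f : V -> R) :
  (forall p, A p -> f p != 0) ->
  smooth_upto k f -> smooth_upto k (fun p => (f p)^-1).
Proof.
move=> f0; elim: k => [|k IH] sf.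
  have [df _] := sf.
  by split=> // p Ap; apply: differentiableV; [exact: df|exact: f0].
have [df Df] := sf; have sV := IH (smooth_upto_pred sf).
split=> [p Ap|v]; first by apply: differentiableV; [exact: df|exact: f0].
have := smooth_uptoM (smooth_upto_cst k (-1 : R)) (smooth_uptoM (smooth_uptoM sV sV) (Df v)).
apply: eq_smooth_upto => p Ap.
rewrite deriveV ?f0//; last exact/diff_derivable/df.
by rewrite /GRing.scale/= -exprVn expr2 mulN1r mulNr.
Qed.

Lemma is_derive_sqrt (f : V -> R) p v : 0 < f p -> differentiable f p ->
  is_derive p v (fun q => Num.sqrt (f q)) ((2 * Num.sqrt (f p))^-1 * 'D_v f p).
Proof.
move=> f0 df; have [ds s'] := is_derive1_sqrt f0.
have dS : differentiable Num.sqrt (f p) by exact/derivable1_diffP.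
have dc : differentiable (Num.sqrt \o f) p by exact: differentiable_comp.
split; first exact: diff_derivable.
rewrite -[LHS]/('D_v (Num.sqrt \o f) p) deriveE// diff_comp//= deriveE//.
by rewrite deriv1E// derive1E s' /GRing.scale/= mulrC.
Qed.

Lemma differentiable_sqrt (f : V -> R) p : 0 < f p -> differentiable f p ->
  differentiable (fun q => Num.sqrt (f q)) p.
Proof.
move=> f0 df; apply: (@differentiable_comp _ _ _ _ f Num.sqrt) => //.
by apply/derivable1_diffP; have [] := is_derive1_sqrt f0.
Qed.

Lemma smooth_upto_sqrt k (f : V -> R) :
  (forall p, A p -> 0 < f p) ->
  smooth_upto k f -> smooth_upto k (fun p => Num.sqrt (f p)).
Proof.
move=> f0; elim: k => [|k IH] sf.
  have [df _] := sf.
  by split=> // p Ap; apply: differentiable_sqrt; [exact: f0|exact: df].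
have [df Df] := sf; have sS := IH (smooth_upto_pred sf).
split=> [p Ap|v]; first by apply: differentiable_sqrt; [exact: f0|exact: df].
have s2 := smooth_uptoM (smooth_upto_cst k (2 : R)) sS.
have {}s2 := smooth_uptoM (smooth_uptoV _ s2) (Df v).
apply: eq_smooth_upto (s2 _) => p Ap.
  by have [_ ->] := is_derive_sqrt v (f0 _ Ap) (df _ Ap).
by rewrite mulf_neq0// gt_eqF// sqrtr_gt0 f0.
Qed.

End SmoothAlgebra.

(** * Coordinates and homogeneity on the slit tangent bundle *)

Section TangentBundle.
Context {R : realType} {n : nat}.
Local Notation vec := 'rV[R]_n.
Local Notation tb := (vec * vec)%type.

Lemma slit_bundle_open (U : set vec) : open U -> open (slit_bundle U).
Proof.
move=> oU; rewrite /slit_bundle.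
have -> : [set p : tb | U p.1 /\ p.2 != 0]
  = (fst @^-1` U) `&` (snd @^-1` (~` [set 0])).
  apply/seteqP; split=> -[x y] /= [Ux y0]; split=> //; exact/eqP.
apply: openI; apply: open_comp => //; first by move=> p _; exact: cvg_fst.
- by move=> p _; exact: cvg_snd.
- rewrite openC; apply: accessible_closed_set1; apply: hausdorff_accessible.
  exact: norm_hausdorff.
Qed.

Lemma differentiable_base_coord (i : 'I_n) (p : tb) :
  differentiable (fun q : tb => q.1 0 i) p.
Proof.
apply: (@differentiable_comp _ _ _ _ fst (fun x : vec => x 0 i)).
  by apply: (@linear_differentiable _ _ _ fst) => q; exact: cvg_fst.
exact: differentiable_coord.
Qed.

Lemma differentiable_fiber_coord (i : 'I_n) (p : tb) :
  differentiable (fun q : tb => q.2 0 i) p.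
Proof.
apply: (@differentiable_comp _ _ _ _ snd (fun x : vec => x 0 i)).
  by apply: (@linear_differentiable _ _ _ snd) => q; exact: cvg_snd.
exact: differentiable_coord.
Qed.

Lemma is_derive_additive (V : normedModType R) (f : V -> R) (p v : V) :
  (forall (h : R), f (h *: v + p) = h * f v + f p) ->
  is_derive p v f (f v).
Proof.
move=> fl; have E : \forall h \near (0 : R)^',
    h^-1 *: (f (h *: v + p) - f p) = f v.
  near=> h; rewrite fl addrK /GRing.scale/= mulKf//.
  by near: h; exact: nbhs_dnbhs_neq.
have C : h^-1 *: (f (h *: v + p) - f p) @[h --> (0 : R)^'] --> f v.
  exact: cvg_near_cst E.
split; first exact: cvgP C.
exact: cvg_lim C.
Unshelve. all: by end_near. Qed.

#[global] Instance is_derive_base_coord (i : 'I_n) (p X : tb) :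
  is_derive p X (fun q : tb => q.1 0 i) (X.1 0 i).
Proof.
by apply: (@is_derive_additive _ (fun q : tb => q.1 0 i)) => h; rewrite !mxE.
Qed.

#[global] Instance is_derive_fiber_coord (i : 'I_n) (p X : tb) :
  is_derive p X (fun q : tb => q.2 0 i) (X.2 0 i).
Proof.
by apply: (@is_derive_additive _ (fun q : tb => q.2 0 i)) => h; rewrite !mxE.
Qed.

Lemma smooth_upto_base_coord (A : set tb) k (i : 'I_n) : open A ->
  smooth_upto A k (fun q : tb => q.1 0 i).
Proof.
move=> oA; have d p : A p -> _ := fun=> differentiable_base_coord i p.
case: k => [|k]; first by split.
split=> // v.
apply: (eq_smooth_upto oA) (smooth_upto_cst oA k (v.1 0 i)) => p _.
by rewrite derive_val.
Qed.

Lemma smooth_upto_fiber_coord (A : set tb) k (i : 'I_n) : open A ->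
  smooth_upto A k (fun q : tb => q.2 0 i).
Proof.
move=> oA; have d p : A p -> _ := fun=> differentiable_fiber_coord i p.
case: k => [|k]; first by split.
split=> // v.
apply: (eq_smooth_upto oA) (smooth_upto_cst oA k (v.2 0 i)) => p _.
by rewrite derive_val.
Qed.

End TangentBundle.

Section FiberHomogeneity.
Context {R : realType} {n : nat}.
Local Notation vec := 'rV[R]_n.
Local Notation tb := (vec * vec)%type.
Variable U : set vec.
Hypothesis Uopen : open U.
Local Notation A := (slit_bundle U).

Let Aopen : open A. Proof. exact: slit_bundle_open. Qed.

(** Positive homogeneity of degree [k] along the fibres, away from the zero
    section, where fibre derivatives may fail to exist. *)
Definition fiber_homog (k : nat) (f : tb -> R) : Prop :=
  forall (p : tb) (l : R), A p -> 0 < l -> f (p.1, l *: p.2) = l ^+ k * f p.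

Lemma slit_scale (p : tb) (l : R) : A p -> 0 < l -> A (p.1, l *: p.2).
Proof. by move=> [Up p0] l0; split=> //=; rewrite scaler_eq0 negb_or gt_eqF. Qed.

Lemma pos_homogeneous1_fiber f : pos_homogeneous1 U f -> fiber_homog 1 f.
Proof. by move=> hf -[x y] l [/= Ux _] l0; rewrite expr1 hf. Qed.

(** Chain rule for the fibrewise dilation by [l], which acts linearly on tangent
    vectors. *)
Lemma derive_fiber_homog k f p l z w : fiber_homog k f -> A p -> 0 < l ->
  differentiable f p ->
  'D_(z, l *: w) f (p.1, l *: p.2) = l ^+ k * 'D_(z, w) f p.
Proof.
move=> hf Ap l0 df; pose m (q : tb) : tb := (q.1, l *: q.2).
have -> : 'D_(z, l *: w) f (p.1, l *: p.2) = 'D_(z, w) (f \o m) p.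
  have E h : h *: (z, l *: w) + (p.1, l *: p.2) = m (h *: (z, w) + p).
    by apply: injective_projections; rewrite //= scalerDr !scalerA mulrC.
  rewrite /derive; set g := (X in X @ _); set g' := (X in _ = lim (X @ _)).
  by suff -> : g = g' by []; apply/funext => h; rewrite /g /g' /= E.
rewrite (_ : l ^+ k * _ = 'D_(z, w) (l ^+ k \*: f) p); last first.
  by rewrite deriveZ//; exact: diff_derivable.
apply: near_eq_derive; apply: (near_open Aopen) => // q Aq.
by rewrite /m /= hf.
Qed.

Lemma fiber_homog_derive_base k f z : smooth_on A f ->
  fiber_homog k f -> fiber_homog k ('D_(z, 0) f).
Proof.
move=> sf hf p l Ap l0.
rewrite -(derive_fiber_homog _ _ hf)// ?scaler0//.
exact: (smooth_on_differentiable sf).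
Qed.

Lemma fiber_homog_derive k f w : smooth_on A f ->
  fiber_homog k.+1 f -> fiber_homog k ('D_(0, w) f).
Proof.
move=> sf hf p l Ap l0; apply: (mulfI (lt0r_neq0 l0)).
have := derive_fiber_homog 0 w hf Ap l0 (smooth_on_differentiable sf Ap).
rewrite exprS -mulrA => <-.
have -> : (0, l *: w) = l *: (0, w) :> tb by congr pair; rewrite scaler0.
by rewrite deriveZdir//; apply: (smooth_on_differentiable sf); exact: slit_scale.
Qed.

(** Euler's identity: along the ray through [p], [f] is [(1 + s) ^+ k * f p]. *)
Lemma euler_homog k f p : smooth_on A f -> fiber_homog k f -> A p ->
  'D_(0, p.2) f p = k%:R * f p.
Proof.
move=> sf hf Ap; have df := smooth_on_differentiable sf Ap.
have E0 : 0 *: (0, p.2) + p = p :> tb by rewrite scale0r add0r.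
have : is_derive (0 : R) 1 (fun s => f (s *: (0, p.2) + p)) ('D_(0, p.2) f p).
  by have := @is_derive_line _ _ _ f p (0, p.2) 0; rewrite E0; apply.
have lineE : \forall s \near (0 : R), f (s *: (0, p.2) + p) = (s + 1) ^+ k * f p.
  near=> s; have s1 : 0 < s + 1.
    rewrite -ltrBlDr sub0r; near: s.
    by apply: lt_nbhsr; rewrite ltrN10.
  rewrite -hf//; congr f; apply: injective_projections => /=.
    by rewrite scaler0 add0r.
  by rewrite scalerDl scale1r.
move/(near_eq_is_derive lineE) => [_ <-].
rewrite (_ : (fun s : R => _) = ((id : R -> R) + cst 1) ^+ k * cst (f p)).
  rewrite derive_val /= /GRing.scale/= mulr0 add0r !fctE/= add0r expr1n addr0.
  by rewrite !mulr1 mulrC.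
by apply/funext => s; rewrite !fctE.
Unshelve. all: by end_near. Qed.

End FiberHomogeneity.

(* Keeps unification from unfolding directional derivatives into limits when
   it compares two of them; they are only handled through their rules below. *)
#[local] Opaque derive.

(** * Projectively flat sprays *)

Section ProjectiveSpray.
Context {R : realType} {n : nat}.
Local Notation vec := 'rV[R]_n.
Local Notation tb := (vec * vec)%type.
Variable U : set vec.
Hypothesis Uopen : open U.
Local Notation A := (slit_bundle U).

Let Aopen : open A. Proof. exact: slit_bundle_open. Qed.

Definition projective_spray (P : tb -> R) (p : tb) : tb :=
  S0 p - (2 * P p) *: liouville p.

Lemma projective_sprayE P p : projective_spray P p = (p.2, - ((2 * P p) *: p.2)).
Proof.
by apply: injective_projections; rewrite /= ?scaler0 ?subr0// sub0r.
Qed.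

Lemma projective_spray_decomp P p :
  projective_spray P p = (p.2, 0) + (- (2 * P p)) *: (0, p.2) :> tb.
Proof. by rewrite projective_sprayE; apply: injective_projections;
  rewrite /= ?scaler0 ?addr0 ?add0r ?scaleNr. Qed.

Lemma derive_split (f : tb -> R) p z w : differentiable f p ->
  'D_(z, w) f p = 'D_(z, 0) f p + 'D_(0, w) f p.
Proof.
move=> df; rewrite -(deriveDdir (z, 0) (0, w) df).
suff -> : (z, w) = (z, 0) + (0, w) :> tb by [].
by apply: injective_projections; rewrite /= ?addr0 ?add0r.
Qed.

Lemma derive_fiber_sum (f : tb -> R) p w : differentiable f p ->
  'D_(0, w) f p = \sum_i w 0 i * 'D_(ddy i) f p.
Proof.
move=> df; rewrite deriveE//.
have -> : (0, w) = \sum_i w 0 i *: ddy i :> tb.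
  rewrite {1}(row_sum_delta w); apply: injective_projections => /=.
    by rewrite raddf_sum/= big1// => i _; rewrite scaler0.
  by rewrite [RHS]raddf_sum.
rewrite linear_sum; apply: eq_bigr => i _.
by rewrite linearZ deriveE.
Qed.

Lemma smooth_comm (f : tb -> R) p X Y : smooth_on A f -> A p ->
  'D_X ('D_Y f) p = 'D_Y ('D_X f) p.
Proof.
move=> sf Ap; apply: derive_comm; last 2 first.
- exact: (smooth_on_differentiable (smooth_on_derive Y sf)).
- exact: (smooth_on_differentiable (smooth_on_derive X sf)).
by apply: (near_open Aopen) => // q; exact: smooth_on_differentiable.
Qed.

Lemma derive_eqA (f g : tb -> R) p X : A p -> (forall q, A q -> f q = g q) ->
  'D_X f p = 'D_X g p.
Proof. by move=> Ap fg; apply: near_eq_derive; exact: (near_open Aopen). Qed.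

Lemma smooth_onM (f g : tb -> R) :
  smooth_on A f -> smooth_on A g -> smooth_on A (fun p => f p * g p).
Proof.
move=> /smooth_uptoP sf /smooth_uptoP sg; apply/smooth_uptoP => k.
exact: smooth_uptoM.
Qed.

Lemma derive_mul (f g : tb -> R) p X : differentiable f p -> differentiable g p ->
  'D_X (fun q => f q * g q) p = f p * 'D_X g p + g p * 'D_X f p.
Proof.
by move=> df dg; rewrite -[LHS]/('D_X (f * g) p) deriveM//; exact: diff_derivable.
Qed.

(** In coordinates the spray is a sum of smooth functions times constant vectors. *)
Lemma projective_spray_semispray P : smooth_on A P ->
  semispray U (projective_spray P).
Proof.
move=> /smooth_uptoP sP; split; last by move=> p _; rewrite projective_sprayE.
apply/smooth_uptoP => k.
pose S (p : tb) : tb := \sum_(i < n) (p.2 0 i *: ddx i) +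
            \sum_(i < n) (((- 2) * P p * p.2 0 i) *: ddy i).
have SE p : projective_spray P p = S p.
  rewrite projective_sprayE /S; apply: injective_projections => /=.
    rewrite !raddf_sum/= [X in _ + X]big1 ?addr0; last by move=> i _; rewrite scaler0.
    exact: row_sum_delta.
  rewrite !raddf_sum/= [X in X + _]big1 ?add0r; last by move=> i _; rewrite scaler0.
  under eq_bigr do rewrite -scalerA.
  by rewrite -scaler_sumr -row_sum_delta mulNr scaleNr.
apply: (eq_smooth_upto Aopen (f := S)) => [p _|]; first by rewrite SE.
apply: (smooth_uptoD Aopen); apply: (smooth_upto_sum Aopen) => i;
  apply: (smooth_uptoZl Aopen); first exact: smooth_upto_fiber_coord.
apply: (smooth_uptoM Aopen); last exact: smooth_upto_fiber_coord.
by apply: (smooth_uptoM Aopen) => //; exact: smooth_upto_cst.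
Qed.

Lemma derive_sqr (f : tb -> R) p X : differentiable f p ->
  'D_X (fun q => f q ^+ 2) p = 2 * f p * 'D_X f p.
Proof.
move=> df; rewrite (_ : (fun q => f q ^+ 2) = (fun q => f q * f q)).
  by rewrite derive_mul//; ring.
by apply/funext => q; rewrite expr2.
Qed.

(** The two-form [d d_J F^2] in terms of derivatives of [F], where the term
    [2 F F_y] is differentiated by the product rule. *)
Lemma d1_dJ_sqr (F : tb -> R) p X Y : smooth_on A F -> A p ->
  d1 (dJ (fun q => F q ^+ 2)) p X Y
  = 2 * (F p * 'D_X ('D_(0, Y.1) F) p + 'D_(0, Y.1) F p * 'D_X F p)
  - 2 * (F p * 'D_Y ('D_(0, X.1) F) p + 'D_(0, X.1) F p * 'D_Y F p).
Proof.
move=> sF Ap.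
have H (Z Z' : tb) : 'D_Z (fun q => dJ (fun q => F q ^+ 2) q Z') p
    = 2 * (F p * 'D_Z ('D_(0, Z'.1) F) p + 'D_(0, Z'.1) F p * 'D_Z F p).
  have dF := smooth_on_differentiable sF Ap.
  have dT := smooth_on_differentiable (smooth_on_derive (0, Z'.1) sF) Ap.
  rewrite (derive_eqA (g := fun q => F q * 'D_(0, Z'.1) F q * 2))//.
    have dFT := differentiableM dF dT.
    by rewrite (derive_mul _ dFT)// derive_cst (derive_mul _ dF dT) mulr0 add0r.
  move=> q Aq; rewrite /dJ /vertJ derive_sqr; first by ring.
  exact: (smooth_on_differentiable sF).
by rewrite /d1 (H X Y) (H Y X).
Qed.

Section Geodesic.
Variables (F P : tb -> R).
Hypothesis FinF : finsler_metric U F.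
Hypothesis sP : smooth_on A P.
Hypothesis Ph : pos_homogeneous1 U P.
Hypothesis F_dx : forall p u, A p ->
  'D_(u, 0) F p = 'D_(0, u) (fun q => P q * F q) p.

Let sF : smooth_on A F := finsler_smooth FinF.
Let F1 : fiber_homog U 1 F := pos_homogeneous1_fiber (finsler_homog FinF).
Let P1 : fiber_homog U 1 P := pos_homogeneous1_fiber Ph.
Let PF2 : fiber_homog U 2 (fun q => P q * F q).
Proof. by move=> p l Ap l0; rewrite P1// F1//; ring. Qed.
Let sPF : smooth_on A (fun q => P q * F q) := smooth_onM sP sF.

(** The right-hand side of [F_dx] with [u = y] is the Euler derivative of the
    2-homogeneous function [P F]. *)
Lemma S0_metric p : A p -> 'D_(p.2, 0) F p = 2 * P p * F p.
Proof.
by move=> Ap; rewrite F_dx// (euler_homog sPF PF2)// mulrA.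
Qed.

Lemma projective_factorE p : A p -> projective_factor F p = P p.
Proof.
move=> Ap; rewrite /projective_factor S0_metric//.
have := finsler_pos FinF Ap => F0.
by field; rewrite gt_eqF.
Qed.

(** Hamel's equation.  Let [y] be the fibre component of [p], kept constant when
    differentiating.  Exchanging derivatives gives, at [p],
    [S0 (F_u) = (F_{x^y})_u = ((P F)_y)_u = ((P F)_u)_y], and Euler's identity
    for the 1-homogeneous function [(P F)_u] concludes. *)
Lemma S0_vertical p u : A p -> 'D_(p.2, 0) ('D_(0, u) F) p = 'D_(u, 0) F p.
Proof.
move=> Ap; rewrite smooth_comm// [RHS]F_dx//.
rewrite (derive_eqA (g := 'D_(0, p.2) (fun q => P q * F q)))//; last first.
  by move=> q Aq; rewrite F_dx.
rewrite smooth_comm//.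
have := euler_homog _ (fiber_homog_derive Uopen u sPF PF2) Ap.
by rewrite mul1r; apply; exact: smooth_on_derive.
Qed.

(** [F] is constant along the spray, and [F_u] has derivative [F_{x^u}] along it
    by Hamel's equation and the 0-homogeneity of [F_u]; what is left of
    [i_S dd_J F^2] is [- dF^2]. *)
Lemma projective_spray_geodesic_eq : geodesic_eq U F (projective_spray P).
Proof.
move=> p [u w] Ap.
have dF := smooth_on_differentiable sF Ap.
have dD X := smooth_on_differentiable (smooth_on_derive X sF) Ap.
have Fy := euler_homog sF F1 Ap; rewrite mul1r in Fy.
have Sp1 : (projective_spray P p).1 = p.2 by rewrite projective_sprayE.
rewrite /interior_prod d1_dJ_sqr// /d0 derive_sqr// Sp1 /=.
have -> : 'D_(projective_spray P p) F p = 0.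
  rewrite projective_spray_decomp deriveDdir// deriveZdir// S0_metric// Fy.
  by rewrite /GRing.scale/=; ring.
have -> : 'D_(projective_spray P p) ('D_(0, u) F) p = 'D_(u, 0) F p.
  rewrite projective_spray_decomp deriveDdir// deriveZdir// S0_vertical//.
  have -> : 'D_(0, p.2) ('D_(0, u) F) p = 0.
    rewrite (euler_homog _ (fiber_homog_derive Uopen u sF F1) Ap) ?mul0r//.
    exact: smooth_on_derive.
  by rewrite scaler0 addr0.
have -> : 'D_(u, w) ('D_(0, p.2) F) p = 'D_(u, 0) F p.
  rewrite smooth_comm//.
  rewrite (derive_eqA (g := fun q => 'D_(u, 0) F q + 'D_(0, w) F q))//; last first.
    by move=> q Aq; rewrite derive_split//; exact: (smooth_on_differentiable sF).
  rewrite -[LHS]/('D_(0, p.2) ('D_(u, 0) F + 'D_(0, w) F) p).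
  rewrite deriveD; try exact/diff_derivable.
  rewrite (euler_homog _ (fiber_homog_derive Uopen w sF F1) Ap); last first.
    exact: smooth_on_derive.
  rewrite (euler_homog _ (fiber_homog_derive_base Uopen u sF F1) Ap); last first.
    exact: smooth_on_derive.
  by rewrite mul0r mul1r addr0.
rewrite Fy.
move: (F p) ('D_(u, 0) F p) ('D_(0, u) F p) ('D_(u, w) F p) => a b c d.
by ring.
Qed.

(** Two solutions differ by a vertical vector [b], and contracting [dd_J F^2] with
    [b] amounts to multiplying [b] by the fundamental tensor, which is invertible. *)
Lemma geodesic_spray_unique (S S' : tb -> tb) p : A p ->
  (S p).1 = p.2 -> (S' p).1 = p.2 ->
  geodesic_eq U F S -> geodesic_eq U F S' -> S' p = S p.
Proof.
move=> Ap S1 S1' gS gS'.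
pose L q := F q ^+ 2.
have sL : smooth_on A L.
  by rewrite /L (_ : (fun q => _) = (fun q => F q * F q)); [exact: smooth_onM|].
have dD X := smooth_on_differentiable (smooth_on_derive X sL) Ap.
have [b Sb] : exists b, S' p = S p + (0, b) :> tb.
  exists ((S' p).2 - (S p).2).
  by apply: injective_projections; rewrite /= ?S1 ?S1' ?addr0// addrC subrK.
have E u : 'D_(0, b) ('D_(0, u) L) p = 0.
  have dT := dD (0, u).
  have E1 : 'D_(S p) ('D_(0, u) L) p = 'D_(S' p) ('D_(0, u) L) p.
    have := gS p (u, 0) Ap; rewrite -(gS' p (u, 0) Ap).
    by rewrite /interior_prod /d1 /dJ /vertJ S1 S1' => /addIr.
  have E2 : 'D_(S' p) ('D_(0, u) L) p
      = 'D_(S p) ('D_(0, u) L) p + 'D_(0, b) ('D_(0, u) L) p.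
    by rewrite Sb; exact: deriveDdir.
  move: E2; rewrite -E1.
  move: ('D_(S p) ('D_(0, u) L) p) ('D_(0, b) ('D_(0, u) L) p) => x y E.
  by apply: (addrI x); rewrite -E addr0.
have bg : b *m fund_tensor F p = 0.
  apply/rowP => j; rewrite !mxE.
  under eq_bigr do rewrite mxE mulrCA.
  rewrite -mulr_sumr -derive_fiber_sum; first by rewrite E mulr0.
  exact: dD.
have b0 : b = 0.
  have fr : row_free (fund_tensor F p) by rewrite /row_free (finsler_regular FinF).
  by apply: (row_free_inj fr); rewrite bg mul0mx.
by rewrite Sb b0; apply: injective_projections; rewrite /= addr0.
Qed.

Theorem projective_geodesic_spray : geodesic_spray U F (projective_spray P).
Proof.
split; [exact: projective_spray_semispray|exact: projective_spray_geodesic_eq|].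
move=> S' [sS' S1'] gS' p Ap.
have S1 : (projective_spray P p).1 = p.2 by rewrite projective_sprayE.
exact: geodesic_spray_unique Ap S1 (S1' p Ap) projective_spray_geodesic_eq gS'.
Qed.

End Geodesic.

Section Curvature.
Variable P : tb -> R.
Hypothesis sP : smooth_on A P.
Hypothesis Ph : pos_homogeneous1 U P.
Hypothesis P_dx : forall p u, A p -> 'D_(u, 0) P p = P p * 'D_(0, u) P p.

Let P1 : fiber_homog U 1 P := pos_homogeneous1_fiber Ph.

Local Notation S := (projective_spray P).

Lemma spray_coef_projective i : spray_coef S i = fun p => P p * p.2 0 i.
Proof.
by apply/funext => p; rewrite /spray_coef projective_sprayE /= !mxE; field.
Qed.

Lemma derive_spray_coef i p X : A p ->
  'D_X (spray_coef S i) p = P p * X.2 0 i + p.2 0 i * 'D_X P p.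
Proof.
move=> Ap; rewrite spray_coef_projective derive_mul ?derive_val//.
  exact: (smooth_on_differentiable sP).
exact: differentiable_fiber_coord.
Qed.

Lemma connection_projective i j p : A p ->
  connection S i j p = p.2 0 i * 'D_(ddy j) P p + P p * (i == j)%:R.
Proof.
move=> Ap; rewrite /connection derive_spray_coef// /ddy /= mxE eqxx/=.
by rewrite addrC.
Qed.

(** [P_dx] and Euler's identity give [S0 P = P ^+ 2]. *)
Lemma derive_spray_P p : A p -> 'D_(S p) P p = - P p ^+ 2.
Proof.
move=> Ap; have dP := smooth_on_differentiable sP Ap.
have Py := euler_homog sP P1 Ap; rewrite mul1r in Py.
rewrite projective_spray_decomp deriveDdir// deriveZdir// P_dx// Py.
by rewrite /GRing.scale/=; ring.
Qed.

(** Exchanging derivatives, [S0 (P_u) = (P_{x^y})_u = (P P_y)_u = P_u P], because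
    [P_y = P] and the derivative of [P_u] along [y] vanishes.  The vertical part of
    the spray does not contribute, as [P_u] is 0-homogeneous. *)
Lemma derive_spray_vertical p u : A p ->
  'D_(S p) ('D_(0, u) P) p = P p * 'D_(0, u) P p.
Proof.
move=> Ap; have dP := smooth_on_differentiable sP Ap.
have dD X := smooth_on_differentiable (smooth_on_derive X sP) Ap.
have Py := euler_homog sP P1 Ap; rewrite mul1r in Py.
have Pyu : 'D_(0, p.2) ('D_(0, u) P) p = 0.
  rewrite (euler_homog _ (fiber_homog_derive Uopen u sP P1) Ap) ?mul0r//.
  exact: smooth_on_derive.
rewrite projective_spray_decomp deriveDdir// deriveZdir// Pyu scaler0 addr0.
rewrite smooth_comm//.
rewrite (derive_eqA (g := fun q => P q * 'D_(0, p.2) P q))//; last first.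
  by move=> q Aq; rewrite P_dx.
by rewrite derive_mul// smooth_comm// Pyu Py mulr0 add0r.
Qed.

Lemma derive_spray_connection i j p : A p ->
  'D_(S p) (connection S i j) p
  = - p.2 0 i * P p * 'D_(ddy j) P p - P p ^+ 2 * (i == j)%:R.
Proof.
move=> Ap; have dP := smooth_on_differentiable sP Ap.
have dD := smooth_on_differentiable (smooth_on_derive (ddy j) sP) Ap.
have dy := differentiable_fiber_coord i p.
rewrite (derive_eqA (g := fun q => q.2 0 i * 'D_(ddy j) P q + P q * (i == j)%:R))//;
  last by move=> q Aq; rewrite connection_projective.
rewrite -[LHS]/('D_(S p) ((fun q : tb => q.2 0 i * 'D_(ddy j) P q)
   + (fun q => P q * (i == j)%:R)) p).
rewrite deriveD; last 2 first.
- by apply/diff_derivable/differentiableM.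
- by apply/diff_derivable/differentiableM.
rewrite !derive_mul// derive_cst derive_spray_vertical// derive_spray_P//.
by rewrite derive_val projective_sprayE /= !mxE; ring.
Qed.

(** With [N^i_j = y^i P_j + P delta^i_j], the product [N^i_k N^k_j] is
    [3 P P_j y^i + P^2 delta^i_j] by Euler's identity for [P], and it enters with
    total coefficient [-1] because [d/dx^j] is replaced by the horizontal
    derivative; [2 P P_j y^i] and [P P_j y^i + P^2 delta^i_j] come from
    [2 dG^i/dx^j] and [- S(N^i_j)]. *)
Theorem projective_spray_flat p X : A p -> jacobi_endo S p X = 0.
Proof.
move=> Ap; rewrite /jacobi_endo big1// => i _; rewrite big1// => j _.
suff -> : jacobi_coef S i j p = 0 by rewrite mul0r scale0r.
have dP := smooth_on_differentiable sP Ap.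
have Py := euler_homog sP P1 Ap; rewrite mul1r in Py.
rewrite /jacobi_coef /delta_x derive_spray_connection// derive_spray_coef//=.
rewrite P_dx// mxE mulr0 add0r.
have -> : \sum_(k < n) connection S k j p * 'D_(ddy k) (spray_coef S i) p
  = \sum_(k < n) connection S i k p * connection S k j p.
  by apply: eq_bigr => k _; rewrite mulrC.
have -> : \sum_(k < n) connection S i k p * connection S k j p
  = 3 * P p * p.2 0 i * 'D_(ddy j) P p + P p ^+ 2 * (i == j)%:R.
  (* Isolates the Kronecker deltas, so that each sum has at most one nonzero
     term or is an Euler sum. *)
  transitivity (\sum_(k < n) (p.2 0 i * 'D_(ddy j) P p * (p.2 0 k * 'D_(ddy k) P p)
     + (i == k)%:R * (P p * connection S k j p)
     + (k == j)%:R * (P p * p.2 0 i * 'D_(ddy k) P p))).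
    apply: eq_bigr => k _; rewrite !connection_projective//.
    by move: ('D_(ddy j) P p) ('D_(ddy k) P p) => a b; ring.
  rewrite !big_split/= -mulr_sumr -derive_fiber_sum// Py.
  rewrite (bigD1 i)//= big1 ?addr0; last first.
    by move=> k ki; rewrite eq_sym (negbTE ki) mul0r.
  rewrite (bigD1 j)//= big1 ?addr0; last first.
    by move=> k kj; rewrite (negbTE kj) mul0r.
  rewrite !eqxx !mul1r connection_projective//.
  by move: ('D_(ddy j) P p) => a; ring.
by rewrite -/(ddy j); move: ('D_(ddy j) P p) => a; ring.
Qed.

End Curvature.
End ProjectiveSpray.

(** * The Funk-type metric and its companion *)

Section DerivationRules.
Context {R : realType} {V : normedModType R}.
Implicit Types (f g : V -> R) (p X : V).

Lemma is_derive_add f g p X a b : is_derive p X f a -> is_derive p X g b ->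
  is_derive p X (fun q => f q + g q) (a + b).
Proof. exact: is_deriveD. Qed.

Lemma is_derive_mul f g p X a b : is_derive p X f a -> is_derive p X g b ->
  is_derive p X (fun q => f q * g q) (a * g p + f p * b).
Proof.
move=> df dg; apply: is_derive_eq (is_deriveM df dg) _.
by rewrite /GRing.scale/= addrC [g p * _]mulrC.
Qed.

Lemma is_derive_scal f p X k a : is_derive p X f a ->
  is_derive p X (fun q => k * f q) (k * a).
Proof. exact: is_deriveZ. Qed.

Lemma is_derive_inv f p X a : f p != 0 -> is_derive p X f a ->
  is_derive p X (fun q => (f q)^-1) (- a / f p ^+ 2).
Proof.
move=> f0 [df <-]; apply: DeriveDef; first exact: derivableV.
by rewrite deriveV// /GRing.scale/= mulNr mulrC mulNr.
Qed.

End DerivationRules.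

Section FunkMetric.
Context {R : realType} {n : nat}.
Local Notation vec := 'rV[R]_n.
Local Notation tb := (vec * vec)%type.
Variables (c : R) (U : set vec).
Hypothesis hU : U `<=` [set x | 4 * c ^+ 2 * enorm x ^+ 2 < 1].
Hypothesis Uopen : open U.
Local Notation A := (slit_bundle U).
Let Aopen : open A. Proof. exact: slit_bundle_open. Qed.

Lemma dotC (x y : vec) : dot x y = dot y x.
Proof. by apply: eq_bigr => i _; rewrite mulrC. Qed.

Lemma dotZr (l : R) (x y : vec) : dot x (l *: y) = l * dot x y.
Proof. by rewrite /dot mulr_sumr; apply: eq_bigr => i _; rewrite mxE mulrCA. Qed.

Lemma dotZl (l : R) (x y : vec) : dot (l *: x) y = l * dot x y.
Proof. by rewrite dotC dotZr dotC. Qed.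

Lemma dot0r (x : vec) : dot x 0 = 0.
Proof. by apply: big1 => i _; rewrite mxE mulr0. Qed.

Lemma enorm_sqr (x : vec) : enorm x ^+ 2 = dot x x.
Proof. by rewrite sqr_sqrtr//; apply: sumr_ge0 => i _; rewrite -expr2 sqr_ge0. Qed.

Lemma dot_gt0 (x : vec) : x != 0 -> 0 < dot x x.
Proof.
move=> x0; rewrite lt0r; apply/andP; split; last first.
  by apply: sumr_ge0 => i _; rewrite -expr2 sqr_ge0.
apply: contra x0 => /eqP/psumr_eq0P x0; apply/eqP/rowP => i; rewrite mxE.
apply/eqP; rewrite -sqrf_eq0 expr2 x0// => j _; by rewrite -expr2 sqr_ge0.
Qed.

(** The radicand of [disc_root], arranged so that it is visibly positive where
    [weight] is. *)
Definition disc (p : tb) : R :=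
  dot p.2 p.2 * (1 - 4 * c ^+ 2 * dot p.1 p.1) + 4 * c ^+ 2 * (dot p.1 p.2 * dot p.1 p.2).

Definition weight (p : tb) : R := 1 - 4 * c ^+ 2 * dot p.1 p.1.

Lemma disc_rootE p : disc_root c p = Num.sqrt (disc p).
Proof. by congr Num.sqrt; rewrite /disc !enorm_sqr; ring. Qed.

Lemma FmetricE p : Fmetric c p = (Num.sqrt (disc p) + 2 * c * dot p.1 p.2) / weight p.
Proof. by rewrite /Fmetric disc_rootE enorm_sqr. Qed.

Lemma weight_gt0 p : A p -> 0 < weight p.
Proof. by move=> [/hU /=]; rewrite enorm_sqr subr_gt0. Qed.

Lemma disc_gt_sqr p : A p -> (2 * c * dot p.1 p.2) ^+ 2 < disc p.
Proof.
move=> Ap; have [_ /dot_gt0 y0] := Ap.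
have -> : disc p = dot p.2 p.2 * weight p + (2 * c * dot p.1 p.2) ^+ 2.
  by rewrite /disc /weight; ring.
by rewrite ltrDr mulr_gt0// weight_gt0.
Qed.

Lemma disc_gt0 p : A p -> 0 < disc p.
Proof. by move=> /disc_gt_sqr; apply: le_lt_trans; exact: sqr_ge0. Qed.

Lemma disc_root_gt0 p : A p -> 0 < disc_root c p.
Proof. by move=> Ap; rewrite disc_rootE sqrtr_gt0 disc_gt0. Qed.

(** The square root dominates [2c<x,y>] in absolute value. *)
Lemma Fmetric_gt0 p : A p -> 0 < Fmetric c p.
Proof.
move=> Ap; rewrite FmetricE divr_gt0 ?weight_gt0//.
rewrite -ltrBlDr sub0r (le_lt_trans (ler_norm _))// normrN -sqrtr_sqr.
by rewrite ltr_sqrt ?disc_gt0// disc_gt_sqr.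
Qed.

Lemma disc_root_Fmetric p : A p ->
  disc_root c p = weight p * Fmetric c p - 2 * c * dot p.1 p.2.
Proof.
by move=> /weight_gt0 w0; rewrite FmetricE disc_rootE; field; rewrite gt_eqF.
Qed.

(** [Fmetric] is a root of a quadratic equation with coefficients polynomial in
    [x] and [y]; with [disc_root_Fmetric] this expresses [|y|^2] and the square root
    rationally in [F], [weight] and [<x,y>]. *)
Lemma Fmetric_quadratic p : A p ->
  dot p.2 p.2 = weight p * Fmetric c p ^+ 2 - 4 * c * dot p.1 p.2 * Fmetric c p.
Proof.
move=> Ap; have w0 := weight_gt0 Ap.
have D2 : disc_root c p ^+ 2 = dot p.2 p.2 * weight p + 4 * c ^+ 2 * dot p.1 p.2 ^+ 2.
  by rewrite disc_rootE sqr_sqrtr ?ltW ?disc_gt0// -[dot p.1 p.2 ^+ 2]expr2.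
move: D2; rewrite disc_root_Fmetric// => D2.
apply: (mulIf (lt0r_neq0 w0)).
by rewrite -[LHS](addrK (4 * c ^+ 2 * dot p.1 p.2 ^+ 2)) -D2; ring.
Qed.

Lemma Fmetric_homog : pos_homogeneous1 U (Fmetric c).
Proof.
move=> x y l _ l0; rewrite !FmetricE /weight /=.
have -> : disc (x, l *: y) = l ^+ 2 * disc (x, y).
  by rewrite /disc /= dotZl !dotZr; ring.
rewrite sqrtrM ?sqr_ge0// sqrtr_sqr gtr0_norm// dotZr.
by rewrite [RHS]mulrA; congr (_ * _); ring.
Qed.

Lemma smooth_upto_dot k (f g : tb -> vec) :
  (forall i, smooth_upto A k (fun q => f q 0 i)) ->
  (forall i, smooth_upto A k (fun q => g q 0 i)) ->
  smooth_upto A k (fun q => dot (f q) (g q)).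
Proof.
by move=> sf sg; apply: smooth_upto_sum => // i; exact: smooth_uptoM.
Qed.

Lemma smooth_upto_disc k : smooth_upto A k disc.
Proof.
have xx : smooth_upto A k (fun q => dot q.1 q.1).
  by apply: smooth_upto_dot => i; exact: smooth_upto_base_coord.
have yy : smooth_upto A k (fun q => dot q.2 q.2).
  by apply: smooth_upto_dot => i; exact: smooth_upto_fiber_coord.
have xy : smooth_upto A k (fun q => dot q.1 q.2).
  by apply: smooth_upto_dot => i; [exact: smooth_upto_base_coord|exact: smooth_upto_fiber_coord].
have cst (l : R) : smooth_upto A k (fun=> l) by exact: smooth_upto_cst.
apply: smooth_uptoD => //; apply: smooth_uptoM => //; last exact: smooth_uptoM.
apply: (eq_smooth_upto Aopen) (smooth_uptoD Aopen (cst 1)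
  (smooth_uptoM Aopen (cst (- (4 * c ^+ 2))) xx)) => p _.
by rewrite mulNr.
Qed.

Lemma smooth_Fmetric : smooth_on A (Fmetric c).
Proof.
apply/smooth_uptoP => k.
have xx : smooth_upto A k (fun q => dot q.1 q.1).
  by apply: smooth_upto_dot => i; exact: smooth_upto_base_coord.
have xy : smooth_upto A k (fun q => dot q.1 q.2).
  by apply: smooth_upto_dot => i; [exact: smooth_upto_base_coord|exact: smooth_upto_fiber_coord].
have cst (l : R) : smooth_upto A k (fun=> l) by exact: smooth_upto_cst.
have sw : smooth_upto A k weight.
  apply: (eq_smooth_upto Aopen) (smooth_uptoD Aopen (cst 1)
    (smooth_uptoM Aopen (cst (- (4 * c ^+ 2))) xx)) => p _.
  by rewrite mulNr.
have sD : smooth_upto A k (fun q => Num.sqrt (disc q)).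
  apply: smooth_upto_sqrt => //; first exact: disc_gt0.
  exact: smooth_upto_disc.
have w0 p : A p -> weight p != 0 by move=> /weight_gt0 /lt0r_neq0.
have := smooth_uptoM Aopen (smooth_uptoD Aopen sD (smooth_uptoM Aopen (cst (2 * c)) xy))
  (smooth_uptoV Aopen w0 sw).
by apply: (eq_smooth_upto Aopen) => p _; rewrite FmetricE.
Qed.

Lemma is_derive_dot (f g : tb -> vec) (p X : tb) (a b : vec) :
  (forall i, is_derive p X (fun q => f q 0 i) (a 0 i)) ->
  (forall i, is_derive p X (fun q => g q 0 i) (b 0 i)) ->
  is_derive p X (fun q => dot (f q) (g q)) (dot a (g p) + dot (f p) b).
Proof.
move=> df dg.
have := is_derive_sum (fun i => is_derive_mul (df i) (dg i)).
rewrite big_split/=; congr (is_derive _ _ _ _).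
by apply/funext => q; rewrite fct_sumE.
Qed.

Lemma is_derive_dot_xx (p X : tb) :
  is_derive p X (fun q => dot q.1 q.1) (2 * dot p.1 X.1).
Proof.
apply: is_derive_eq; first exact: is_derive_dot.
by rewrite dotC; ring.
Qed.

Lemma is_derive_dot_yy (p X : tb) :
  is_derive p X (fun q => dot q.2 q.2) (2 * dot p.2 X.2).
Proof.
apply: is_derive_eq; first exact: is_derive_dot.
by rewrite dotC; ring.
Qed.

Lemma is_derive_dot_xy (p X : tb) :
  is_derive p X (fun q => dot q.1 q.2) (dot p.2 X.1 + dot p.1 X.2).
Proof.
apply: is_derive_eq; first exact: is_derive_dot.
by rewrite dotC.
Qed.

Lemma is_derive_dot_vx (v : vec) (p X : tb) :
  is_derive p X (fun q => dot v q.1) (dot v X.1).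
Proof.
apply: is_derive_eq.
  apply: (@is_derive_dot (fun=> v) fst p X 0) => i.
  by rewrite mxE; exact: is_derive_cst.
by rewrite (dotC 0) dot0r add0r.
Qed.

Lemma is_derive_dot_vy (v : vec) (p X : tb) :
  is_derive p X (fun q => dot v q.2) (dot v X.2).
Proof.
apply: is_derive_eq.
  apply: (@is_derive_dot (fun=> v) snd p X 0) => i.
  by rewrite mxE; exact: is_derive_cst.
by rewrite (dotC 0) dot0r add0r.
Qed.

Lemma is_derive_weight (p X : tb) :
  is_derive p X weight (- (8 * c ^+ 2 * dot p.1 X.1)).
Proof.
have := is_derive_add (is_derive_cst (1 : R) p X)
  (is_derive_scal (- (4 * c ^+ 2)) (is_derive_dot_xx p X)).
rewrite (_ : (fun q => _) = weight); last by apply/funext => q; rewrite mulNr.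
by move/is_derive_eq; apply; ring.
Qed.

Lemma is_derive_disc (p X : tb) :
  is_derive p X disc (2 * dot p.2 X.2 * weight p
    - 8 * c ^+ 2 * dot p.2 p.2 * dot p.1 X.1
    + 8 * c ^+ 2 * dot p.1 p.2 * (dot p.2 X.1 + dot p.1 X.2)).
Proof.
have xy := is_derive_dot_xy p X.
have := is_derive_add (is_derive_mul (is_derive_dot_yy p X) (is_derive_weight p X))
  (is_derive_scal (4 * c ^+ 2) (is_derive_mul xy xy)).
by move/is_derive_eq; apply; ring.
Qed.

Lemma is_derive_Fmetric (p X : tb) : A p ->
  is_derive p X (Fmetric c)
    ((((2 * disc_root c p)^-1 * (2 * dot p.2 X.2 * weight p
        - 8 * c ^+ 2 * dot p.2 p.2 * dot p.1 X.1
        + 8 * c ^+ 2 * dot p.1 p.2 * (dot p.2 X.1 + dot p.1 X.2)))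
      + 2 * c * (dot p.2 X.1 + dot p.1 X.2)
      + 8 * c ^+ 2 * dot p.1 X.1 * Fmetric c p) / weight p).
Proof.
move=> Ap; have w0 := lt0r_neq0 (weight_gt0 Ap).
have [_ dd] := is_derive_disc p X.
have dsm : differentiable disc p := smooth_upto_diff (smooth_upto_disc 0) Ap.
have dD := is_derive_sqrt X (disc_gt0 Ap) dsm; rewrite dd -disc_rootE in dD.
have dN := is_derive_add dD (is_derive_scal (2 * c) (is_derive_dot_xy p X)).
have := is_derive_mul dN (is_derive_inv w0 (is_derive_weight p X)).
rewrite (_ : (fun q => _) = Fmetric c); last by apply/funext => q; rewrite FmetricE.
move/is_derive_eq; apply.
rewrite FmetricE -disc_rootE.
set D := disc_root c p; have D0 : D != 0 by rewrite lt0r_neq0// disc_root_gt0.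
by field; rewrite D0 w0.
Qed.

(** The fibre derivative of [Fmetric c] along [u], as read off from its quadratic
    equation. *)
Definition funk_dy (p : tb) (u : vec) : R :=
  (2 * c * Fmetric c p * dot p.1 u + dot p.2 u) / disc_root c p.

(** The equation [F_x = 2cF F_y] in both directions at once: the base derivative is
    [2cF] times the fibre derivative. *)
Lemma Fmetric_derive (p : tb) (z w : vec) : A p ->
  is_derive p (z, w) (Fmetric c) (2 * c * Fmetric c p * funk_dy p z + funk_dy p w).
Proof.
move=> Ap; have w0 := lt0r_neq0 (weight_gt0 Ap).
have D0 := lt0r_neq0 (disc_root_gt0 Ap).
move: (is_derive_Fmetric (z, w) Ap) => /is_derive_eq; apply.
rewrite /funk_dy /= Fmetric_quadratic//.
move: D0; rewrite disc_root_Fmetric// => D0.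
by field; rewrite D0 w0.
Qed.

(** Obtained by differentiating [D = weight * F - 2c<x,y>] rather than the square
    root, so that only [funk_dy] appears: [D_x = 2cF D_y - 2cD F_y]. *)
Lemma disc_root_derive (p : tb) (z w : vec) : A p ->
  is_derive p (z, w) (disc_root c)
   (2 * c * Fmetric c p * (weight p * funk_dy p z - 2 * c * dot p.1 z)
    - 2 * c * disc_root c p * funk_dy p z
    + (weight p * funk_dy p w - 2 * c * dot p.1 w)).
Proof.
move=> Ap; have D0 := lt0r_neq0 (disc_root_gt0 Ap).
have := is_derive_add (is_derive_mul (is_derive_weight p (z, w)) (Fmetric_derive z w Ap))
  (is_derive_scal (- (2 * c)) (is_derive_dot_xy p (z, w))).
move/(near_eq_is_derive _)/is_derive_eq; apply.
  apply: (near_open Aopen) => // q Aq.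
  by rewrite disc_root_Fmetric// mulNr.
have -> : dot p.2 z = disc_root c p * funk_dy p z - 2 * c * Fmetric c p * dot p.1 z.
  by rewrite /funk_dy; field.
by rewrite /=; ring.
Qed.

Section Ftilde.
Variables (eta e : R) (v : vec).

Lemma FtildeE p : Ftilde c eta e v p =
  eta * (Fmetric c p * Fmetric c p * (disc_root c p)^-1
    * (2 * c * dot v p.1 + e + dot v p.2 * (Fmetric c p)^-1)).
Proof.
rewrite /Ftilde {2 3}/Fmetric invfM -exprVn.
by move: (_^-1) (_^-1) (_^-1) => a b d; ring.
Qed.

(** Only the relation between the base and the fibre derivative matters, so the value
    of the latter is left implicit. *)
Lemma Ftilde_derive_rules p u : A p -> exists2 d,
  is_derive p (0, u) (Ftilde c eta e v) d &
  is_derive p (u, 0) (Ftilde c eta e v)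
    (2 * c * (funk_dy p u * Ftilde c eta e v p + Fmetric c p * d)).
Proof.
move=> Ap; have F0 := lt0r_neq0 (Fmetric_gt0 Ap).
have D0 := lt0r_neq0 (disc_root_gt0 Ap).
have rule z w := is_derive_scal eta
  (is_derive_mul (is_derive_mul
     (is_derive_mul (Fmetric_derive z w Ap) (Fmetric_derive z w Ap))
     (is_derive_inv D0 (disc_root_derive z w Ap)))
   (is_derive_add (is_derive_add
      (is_derive_scal (2 * c) (is_derive_dot_vx v p (z, w)))
      (is_derive_cst e p (z, w)))
    (is_derive_mul (is_derive_dot_vy v p (z, w))
       (is_derive_inv F0 (Fmetric_derive z w Ap))))).
have FE : (fun q => eta * (Fmetric c q * Fmetric c q * (disc_root c q)^-1
    * (2 * c * dot v q.1 + e + dot v q.2 * (Fmetric c q)^-1))) = Ftilde c eta e v.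
  by apply/funext => q; rewrite FtildeE.
have d0 : funk_dy p 0 = 0 by rewrite /funk_dy !dot0r mulr0 addr0 mul0r.
have ruley := rule 0 u; rewrite FE in ruley.
refine (ex_intro2 _ _ _ ruley _).
have := rule u 0; rewrite FE => /is_derive_eq; apply.
rewrite FtildeE /= d0 !dot0r.
by field; rewrite F0 D0.
Qed.

Lemma Ftilde_dx p u : A p ->
  'D_(u, 0) (Ftilde c eta e v) p
  = 'D_(0, u) (fun q => 2 * c * Fmetric c q * Ftilde c eta e v q) p.
Proof.
move=> Ap; have [d dy [_ ->]] := Ftilde_derive_rules u Ap.
have [_ ->] := is_derive_mul (is_derive_scal (2 * c) (Fmetric_derive 0 u Ap)) dy.
have -> : funk_dy p 0 = 0 by rewrite /funk_dy !dot0r mulr0 addr0 mul0r.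
by ring.
Qed.

End Ftilde.

Lemma Fmetric_dx p u : A p ->
  'D_(u, 0) (fun q => 2 * c * Fmetric c q) p
  = 2 * c * Fmetric c p * 'D_(0, u) (fun q => 2 * c * Fmetric c q) p.
Proof.
move=> Ap.
have [_ ->] := is_derive_scal (2 * c) (Fmetric_derive u 0 Ap).
have [_ ->] := is_derive_scal (2 * c) (Fmetric_derive 0 u Ap).
have -> : funk_dy p 0 = 0 by rewrite /funk_dy !dot0r mulr0 addr0 mul0r.
by ring.
Qed.

End FunkMetric.

Theorem mainTheorem11 (R : realType) (n : nat) (hn : (2 <= n)%N)
    (c eta e : R) (v : 'rV[R]_n) (U : set 'rV[R]_n)
    (hc : c != 0) (heta : 0 < eta)
    (hU : U `<=` [set x | 4 * c ^+ 2 * enorm x ^+ 2 < 1])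
    (Uopen : open U) (Uconvex : convex_set U)
    (Fpos : forall p, slit_bundle U p -> 0 < Ftilde c eta e v p)
    (Fin : finsler_metric U (Ftilde c eta e v)) :
  [/\ projectively_flat_with U (Ftilde c eta e v) (fun p => 2 * c * Fmetric c p),
      forall p, slit_bundle U p ->
        projective_factor (Ftilde c eta e v) p = 2 * c * Fmetric c p &
      constant_flag_curvature U (Ftilde c eta e v) 0].
Proof.
pose P (p : 'rV[R]_n * 'rV[R]_n) := 2 * c * Fmetric c p.
have Aopen := slit_bundle_open Uopen.
have sP : smooth_on (slit_bundle U) P.
  apply/smooth_uptoP => k; apply: smooth_uptoM => //.
    exact: smooth_upto_cst.
  by have /smooth_uptoP := smooth_Fmetric hU Uopen; exact.
have Ph : pos_homogeneous1 U P.
  have Fh : pos_homogeneous1 U (Fmetric c) by exact: Fmetric_homog.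
  by move=> x y l Ux l0; rewrite /P Fh//; ring.
have F_dx p u : slit_bundle U p -> 'D_(u, 0) (Ftilde c eta e v) p
    = 'D_(0, u) (fun q => P q * Ftilde c eta e v q) p.
  exact: Ftilde_dx.
have spray := projective_geodesic_spray Uopen Fin sP Ph F_dx.
split.
- by split.
- exact: projective_factorE F_dx.
- exists (projective_spray P); split=> // p X Ap.
  rewrite (projective_spray_flat Uopen sP Ph)//; last first.
    by move=> q u; exact: Fmetric_dx.
  by rewrite !mul0r !scale0r subr0.
Qed.
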